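(* Let $S$ be a regular semigroup weakly generated by an element $a\in S$. Then there is a surjective semigroup homomorphism $F_1\to S$ that sends $[x]$ to $a$.
   Context: A semigroup is regular if for each element $s$ there is $t$ with $sts=s$. A regular semigroup $S$ is weakly generated by a subset (or element) if no proper regular subsemigroup of $S$ contains that subset (element). **The set $G$.** Let $A=\{1,x,x'\}$ (three distinct symbols) with involution $'$ exchanging $x$ and $x'$ and fixing $1$. A 5-tuple is written $g=(g^{l},g^{la},g^{c},g^{ra},g^{r})$. Put $g_{xx'}=(1,1,x,x',1)$, $G_{1,e}=\{g_{xx'}\}$ and, for $i\ge 2$, $G_{i,e}=\{(g,(g^{la})',g^l,(g^{ra})',g),\ (g,(g^{ra})',g^l,(g^{la})',g) : g\in G_{i-1,e}\}$. Put $G_{1,d}=G_{2,d}=\emptyset$ and $G_i=G_{i,e}\cup G_{i,d}$, where recursively for $i\ge 3$, $G_{i,d}$ is the set of all $g\in G_{i-1}\times A\times G_{i-2}\times A\times G_{i-1}$ such that: (1) $g^l\neq g^r$; (2) $(g^c,g^{la})$ equals $((g^l)^l,((g^l)^{la})')$ or $((g^l)^r,((g^l)^{ra})')$; (3) $(g^c,g^{ra})$ equals $((g^r)^l,((g^r)^{la})')$ or $((g^r)^r,((g^r)^{ra})')$. Let $G^5=\bigcup_{i\ge1}G_i$, $G'=G^5\cup\{1\}$, $G=G^5\cup A$. The height is $\upsilon(1)=0$ and $\upsilon(g)=i$ for $g\in G_i$. **The semigroups $F_1^1$ and $F_1$.** For $g\in G^5$ with $\upsilon(g)\ge2$ let $g^L=(g^{la})'g^lg^{la}$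 and $g^R=(g^{ra})'g^rg^{ra}$, words in the free semigroup $G^+$. Let $\rho$ be the smallest congruence on $G^+$ containing the pairs $(xx'x,x)$, $(x'xx',x')$, $(g_{xx'},xx')$; the pairs $(1g,g)$, $(g1,g)$ for $g\in G$; the pairs $(g^2,g)$ for $g\in G'$; and, for every $g\in G^5$ with $\upsilon(g)\ge 2$, the pairs $(g^cg^Lg,g)$, $(gg^Rg^c,g)$ and $(g^rg^{ra}g(g^{la})'g^l,\ g^rg^{ra}g^c(g^{la})'g^l)$. Write $[u]$ for the $\rho$-class of $u$. Then $F_1^1=G^+/\rho$ is a monoid with identity $[1]$, and $F_1=F_1^1\setminus\{[1]\}$ is a subsemigroup. *)

(* Defs.v *)
From HB Require Import structures.
From mathcomp Require Import all_boot.
From mathcomp Require Import boolp classical_sets.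

Set Implicit Arguments.
Unset Strict Implicit.
Unset Printing Implicit Defensive.

Local Open Scope group_scope.
Local Open Scope classical_set_scope.
Local Open Scope quotient_scope.

Definition regular (S : semigroupType) := forall s : S, exists t : S, s * t * s = s.

Definition regular_subsemigroup (S : semigroupType) (T : set S) :=
  (forall s t, T s -> T t -> T (s * t)) /\
  (forall s, T s -> exists2 t, T t & s * t * s = s).

Definition weakly_generated (S : semigroupType) (B : set S) :=
  forall T : set S, regular_subsemigroup T -> B `<=` T -> T = setT.

(* The alphabet A = {1, x, x'}. *)
Inductive symb := One | X | X'.

Definition bar (a : symb) := match a with One => One | X => X' | X' => X end.

(* Raw iterated 5-tuples (g^l, g^la, g^c, g^ra, g^r) over A; the elements of G
   are the trees satisfying [Gset] below. *)
Inductive tree :=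
  | Sym of symb
  | Tup of tree & symb & tree & symb & tree.

HB.instance Definition _ := gen_eqMixin tree.
HB.instance Definition _ := gen_choiceMixin tree.

(* The components, with junk value 1 on the symbols of A. *)
Definition tl g := if g is Tup l _ _ _ _ then l else Sym One.
Definition tla g := if g is Tup _ la _ _ _ then la else One.
Definition tc g := if g is Tup _ _ c _ _ then c else Sym One.
Definition tra g := if g is Tup _ _ _ ra _ then ra else One.
Definition tr g := if g is Tup _ _ _ _ r then r else Sym One.

Definition gxx' := Tup (Sym One) One (Sym X) X' (Sym One).

(* G_{i,e} *)
Fixpoint Ge (i : nat) : set tree :=
  match i with
  | 0 => set0
  | 1 => [set gxx']
  | j.+1 => [set h | exists2 g, Ge j g &
      h = Tup g (bar (tla g)) (tl g) (bar (tra g)) g \/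
      h = Tup g (bar (tra g)) (tl g) (bar (tla g)) g]
  end.

(* G_{i,d}, given P = G_{i-1} and Q = G_{i-2}. *)
Definition Gd_of (P Q : set tree) : set tree :=
  [set g | if g is Tup l la c ra r then
    [/\ P l, Q c & P r] /\
    [/\ l <> r,
        (c, la) = (tl l, bar (tla l)) \/ (c, la) = (tr l, bar (tra l)) &
        (c, ra) = (tl r, bar (tla r)) \/ (c, ra) = (tr r, bar (tra r))]
   else False].

Fixpoint Glev (i : nat) : set tree :=
  Ge i `|` match i with
           | ((_.+1 as k).+1 as j).+1 => Gd_of (Glev j) (Glev k)
           | _ => set0
           end.

Definition G5 : set tree := [set g | exists2 i, (0 < i)%N & Glev i g].

Definition Gset : set tree := G5 `|` range Sym.

Fixpoint height (g : tree) : nat :=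
  if g is Tup l _ _ _ _ then (height l).+1 else 0.

Lemma Ge_height i g : Ge i g -> height g = i.
Proof.
elim: i g => [//|[|i] IH] g /=; first by move=> ->.
by move=> [h /IH hi] [] -> /=; rewrite hi.
Qed.

(* [height] is the function upsilon: the levels are disjoint. *)
Lemma Glev_height i g : Glev i g -> height g = i.
Proof.
elim: i g => [|i IH] g [/Ge_height//|] //.
case: i IH => [|[|i]] // IH.
by case: g => //= l la c ra r [[/IH -> _ _] _].
Qed.

Lemma Glev_components i g : Glev i.+2 g ->
  [/\ Glev i.+1 (tl g), Glev i.+1 (tr g) & Gset (tc g)].
Proof.
case=> [[h hG]|].
  have hG' : Glev i.+1 h by left.
  suff hl : Gset (tl h) by case=> ->.
  case: i hG {hG'} => [->|i [k kG]]; first by right; exists One.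
  by case=> ->; left; exists i.+1 => //; left.
case: i => [|i] //; case: g => // l la c ra r [[Gl Gc Gr] _].
by split=> //; left; exists i.+1.
Qed.

Lemma Gset_components g : Gset g -> [/\ Gset (tl g), Gset (tr g) & Gset (tc g)].
Proof.
have Gsym a : Gset (Sym a) by right; exists a.
case=> [[[//|[|i]] _ gG]|[a _ <-]]; last by split; apply: Gsym.
  by case: gG => [->|//]; split; apply: Gsym.
by have [Gl Gr Gc] := Glev_components gG; split => //; left; exists i.+1.
Qed.

Definition G := {g : tree | g \in Gset}.
HB.instance Definition _ := SubChoice.on G.

Fact Gsym_subproof a : Sym a \in Gset.
Proof. by apply/mem_set; right; exists a. Qed.
Definition Gsym (a : symb) : G := Sub (Sym a) (Gsym_subproof a).

Fact Gxx'_subproof : gxx' \in Gset.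
Proof. by apply/mem_set; left; exists 1%N => //; left. Qed.
Definition Gxx' : G := Sub gxx' Gxx'_subproof.

Fact Gl_subproof (g : G) : tl (val g) \in Gset.
Proof. by apply/mem_set; have [] := Gset_components (set_mem (valP g)). Qed.
Definition Gl (g : G) : G := Sub (tl (val g)) (Gl_subproof g).

Fact Gr_subproof (g : G) : tr (val g) \in Gset.
Proof. by apply/mem_set; have [] := Gset_components (set_mem (valP g)). Qed.
Definition Gr (g : G) : G := Sub (tr (val g)) (Gr_subproof g).

Fact Gc_subproof (g : G) : tc (val g) \in Gset.
Proof. by apply/mem_set; have [] := Gset_components (set_mem (valP g)). Qed.
Definition Gc (g : G) : G := Sub (tc (val g)) (Gc_subproof g).

Definition Gla (g : G) : symb := tla (val g).
Definition Gra (g : G) : symb := tra (val g).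

(* The free semigroup G^+. *)
Definition word := {w : seq G | w != [::]}.
HB.instance Definition _ := SubChoice.on word.

Fact word_mul_subproof (u v : word) : val u ++ val v != [::].
Proof. by case: u => -[]. Qed.
Definition word_mul (u v : word) : word := Sub (val u ++ val v) (word_mul_subproof u v).

Fact word_mulA : associative word_mul.
Proof. by move=> u v w; apply/val_inj; rewrite /= catA. Qed.
HB.instance Definition _ := isSemigroup.Build word word_mulA.

Definition letter (g : G) : word := Sub [:: g] isT.
Definition sletter (a : symb) : word := letter (Gsym a).

Definition word_L (g : G) : word :=
  sletter (bar (Gla g)) * letter (Gl g) * sletter (Gla g).
Definition word_R (g : G) : word :=
  sletter (bar (Gra g)) * letter (Gr g) * sletter (Gra g).

Inductive relator : word -> word -> Prop :=
  | rel_x : relator (sletter X * sletter X' * sletter X) (sletter X)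
  | rel_x' : relator (sletter X' * sletter X * sletter X') (sletter X')
  | rel_gxx' : relator (letter Gxx') (sletter X * sletter X')
  | rel_1g g : relator (sletter One * letter g) (letter g)
  | rel_g1 g : relator (letter g * sletter One) (letter g)
  | rel_idem (g : G) of G5 (val g) \/ val g = Sym One :
      relator (letter g * letter g) (letter g)
  | rel_L (g : G) of G5 (val g) & (2 <= height (val g))%N :
      relator (letter (Gc g) * word_L g * letter g) (letter g)
  | rel_R (g : G) of G5 (val g) & (2 <= height (val g))%N :
      relator (letter g * word_R g * letter (Gc g)) (letter g)
  | rel_M (g : G) of G5 (val g) & (2 <= height (val g))%N :
      relator
        (letter (Gr g) * sletter (Gra g) * letter g
           * sletter (bar (Gla g)) * letter (Gl g))
        (letter (Gr g) * sletter (Gra g) * letter (Gc g)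
           * sletter (bar (Gla g)) * letter (Gl g)).

Definition congruence (S : semigroupType) (R : rel S) :=
  [/\ reflexive R, symmetric R, transitive R &
      forall u u' v v', R u u' -> R v v' -> R (u * v) (u' * v')].

(* The smallest congruence containing the relators. *)
Definition rho : rel word := fun u v =>
  `[< forall R : rel word, congruence R ->
        (forall u v, relator u v -> R u v) -> R u v >].

Lemma relator_rho u v : relator u v -> rho u v.
Proof. by move=> uv; apply/asboolP => R _; apply. Qed.

Lemma rho_min (R : rel word) : congruence R ->
  (forall u v, relator u v -> R u v) -> forall u v, rho u v -> R u v.
Proof. by move=> cR relR u v /asboolP; apply. Qed.

Lemma rho_congruence : congruence rho.
Proof.
split=> [u|u v|v u w /asboolP uv /asboolP vw|
  u u' v v' /asboolP uu' /asboolP vv'].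
- by apply/asboolP => R [].
- by apply/idP/idP => /asboolP uv; apply/asboolP => R cR relR;
    have [_ -> _ _] := cR; apply: uv.
- by apply/asboolP => R cR relR; have [_ _ tR _] := cR;
    apply: (tR v); [apply: uv|apply: vw].
- by apply/asboolP => R cR relR; have [_ _ _ mR] := cR;
    apply: mR; [apply: uu'|apply: vv'].
Qed.

Fact rho_refl : reflexive rho. Proof. by have [] := rho_congruence. Qed.
Fact rho_sym : symmetric rho. Proof. by have [] := rho_congruence. Qed.
Fact rho_trans : transitive rho. Proof. by have [] := rho_congruence. Qed.
Lemma rhoM u u' v v' : rho u u' -> rho v v' -> rho (u * v) (u' * v').
Proof. by have [_ _ _] := rho_congruence; apply. Qed.

Canonical rho_equiv := EquivRel rho rho_refl rho_sym rho_trans.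

(* F_1^1 = G^+ / rho, with [u] written \pi_F11 u. *)
Definition F11 := {eq_quot rho}.
HB.instance Definition _ := Choice.on F11.
HB.instance Definition _ := EqQuotient.on F11.

Lemma F11_eqP u v : reflect (\pi_F11 u = \pi_F11 v) (rho u v).
Proof. exact: (iffP (eqmodP _ _ _)). Qed.

Definition F11_mul (p q : F11) : F11 := \pi_F11 (repr p * repr q).

Lemma F11_mulE u v : F11_mul (\pi_F11 u) (\pi_F11 v) = \pi_F11 (u * v).
Proof. by apply/F11_eqP/rhoM; apply/F11_eqP; rewrite reprK. Qed.

Fact F11_mulA : associative F11_mul.
Proof.
elim/quotW => u; elim/quotW => v; elim/quotW => w.
by rewrite (F11_mulE v w) (F11_mulE u v) 2!F11_mulE mulgA.
Qed.

Definition F11_one : F11 := \pi_F11 (sletter One).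

Lemma word_ind (P : word -> Prop) : (forall g, P (letter g)) ->
  (forall u v, P u -> P v -> P (u * v)) -> forall w, P w.
Proof.
move=> Pl PM [[//|g s] sN]; elim: s g sN => [|h s IH] g sN.
  by rewrite (_ : exist _ _ _ = letter g) //; apply: val_inj.
rewrite (_ : exist _ _ _ = letter g * (Sub (h :: s) isT : word)); last exact: val_inj.
by apply: PM => //; apply: IH.
Qed.

Fact F11_mul1g : left_id F11_one F11_mul.
Proof.
elim/quotW; elim/word_ind => [g|u v IHu _].
  by rewrite F11_mulE; apply/F11_eqP/relator_rho/rel_1g.
by rewrite -F11_mulE F11_mulA IHu.
Qed.

Fact F11_mulg1 : right_id F11_one F11_mul.
Proof.
elim/quotW; elim/word_ind => [g|u v _ IHv].
  by rewrite F11_mulE; apply/F11_eqP/relator_rho/rel_g1.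
by rewrite -F11_mulE -F11_mulA IHv.
Qed.

HB.instance Definition _ := isMonoid.Build F11 F11_mulA F11_mul1g F11_mulg1.

Lemma pi_F11M u v : \pi_F11 (u * v) = \pi_F11 u * \pi_F11 v.
Proof. by rewrite -F11_mulE. Qed.

(* The class of 1 consists of the powers of 1, whence F_1^1 \ {[1]} is closed
   under multiplication. *)
Definition has_non1 (w : word) := has (fun g : G => val g != Sym One) (val w).

Lemma has_non1M u v : has_non1 (u * v) = has_non1 u || has_non1 v.
Proof. exact: has_cat. Qed.

Lemma has_non1_letter g : has_non1 (letter g) = (val g != Sym One).
Proof. exact: orbF. Qed.

Lemma rho_has_non1 u v : rho u v -> has_non1 u = has_non1 v.
Proof.
move=> uv; apply/eqP; move: u v uv.
apply: (rho_min (R := fun u v => has_non1 u == has_non1 v)).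
  split=> [u|u v|v u w /eqP-> //|u u' v v' /eqP uu' /eqP vv'].
  - exact: eqxx.
  - exact: eq_sym.
  - by rewrite !has_non1M uu' vv'.
have XN : Sym X != Sym One by apply/eqP.
have X'N : Sym X' != Sym One by apply/eqP.
have GN g : (2 <= height g)%N -> (g != Sym One) /\ (tl g != Sym One).
  by case: g => // -[] // l la c ra r; split; apply/eqP.
move=> _ _ [|||g|g|g _|g _ /GN[gN lN]|g _ /GN[gN lN]|g _ /GN[gN lN]];
  rewrite ?has_non1M !has_non1_letter /= ?eqxx ?XN ?X'N ?gN ?lN ?orbT ?orbF ?orbb //.
by apply/eqP/eqP.
Qed.

Lemma pi_F11_eq1 u : (\pi_F11 u == F11_one) = ~~ has_non1 u.
Proof.
apply/eqP/idP => [/F11_eqP/rho_has_non1 ->|].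
  by rewrite has_non1_letter /= eqxx.
elim/word_ind: u => [g|u v IHu IHv].
  rewrite has_non1_letter negbK => /eqP g1.
  by congr (\pi_F11 (letter _)); apply: val_inj.
by rewrite has_non1M negb_or pi_F11M => /andP[/IHu-> /IHv->]; apply: F11_mul1g.
Qed.

Definition F1_pred : pred F11 := fun p => p != F11_one.

Definition F1 := {p : F11 | F1_pred p}.
HB.instance Definition _ := SubChoice.on F1.

Fact F1_mulg_closed : mulg_closed F1_pred.
Proof.
elim/quotW => u; elim/quotW => v; rewrite !unfold_in /F1_pred -pi_F11M.
by rewrite !pi_F11_eq1 !negbK has_non1M => ->.
Qed.

HB.instance Definition _ := SubChoice_isSubSemigroup.Build F11 F1_pred F1 F1_mulg_closed.

Fact F1_x_subproof : F1_pred (\pi_F11 (sletter X)).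
Proof.
rewrite /F1_pred pi_F11_eq1 negbK has_non1_letter.
exact/eqP.
Qed.
Definition F1_x : F1 := Sub (\pi_F11 (sletter X)) F1_x_subproof.

(* Main.v *)
Require Import Defs.
From HB Require Import structures.
From mathcomp Require Import all_boot.
From mathcomp Require Import boolp classical_sets.

(** Two independent facts give the theorem.

    The first is that F_1 is regular, and indeed so is the image of G^+ under
    every map [phi] of the letters into a monoid that satisfies the defining
    relations ([model], [eval_regular]).  Draw the graph on G' in which [k] is
    joined upwards to [p], with a label [s] in A, when [(k, s)] is the left pair
    [(p^l, p^la)] or the right pair [(p^r, p^ra)] of [p].  A walk in this graph
    spells a word: an upward edge contributes [k s p], a downward one [p s' k],
    consecutive edges sharing their common node.  Every letter has the value
    of a closed walk at 1, so every word does.  In a walk, a valley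
    [p t' k s q], with [k] below [p] and [q], either cancels ([p t' k t p = p])
    or can be filled: the tuple [d = (q, s', k, t', p)] lies in G, and the
    relation [g^r g^ra g g^la' g^l = g^r g^ra g^c g^la' g^l] for [g = d] turns
    the valley into the peak [p t' d s q].  Filling valleys turns every closed
    walk at 1 into a mountain, an ascent followed by a descent
    ([ascent_up], [mountain_eval]).  Since [p t' k t p = p], going down from a
    summit and back up along the same edges has the value of the summit, so
    the mountain traversed backwards is a generalized inverse of the mountain.

    The second is that the relations can be realized in S with an identity
    adjoined, with [x] sent to [a], [x'] to an inverse of [a], and [g_xx'] to
    their product.  Once [c], [l] and [r] (the images of [g^c], [g^l], [g^r])
    are known, put [w = r g^ra c g^la' l] and choose an inverse [t] of [w]; then
    [c g^la' l t r g^ra c] can serve as the image of [g]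
    ([sandwich_of_inverse], [interp_model]).

    The image of F_1 in S is then a regular subsemigroup containing [a], hence
    it is all of S. *)

Set Implicit Arguments.
Unset Strict Implicit.
Unset Printing Implicit Defensive.

Local Open Scope group_scope.

(** * The covering graph of G' *)

Definition up (k : tree) (s : symb) (p : tree) :=
  G5 p /\ ((k, s) = (tl p, tla p) \/ (k, s) = (tr p, tra p)).

Lemma barK : involutive bar. Proof. by case. Qed.

Lemma G5_height g : G5 g -> (0 < height g)%N /\ Glev (height g) g.
Proof. by case=> i i0 gi; rewrite (Glev_height gi). Qed.

Lemma Glev_G5 i g : Glev i.+1 g -> G5 g.
Proof. by exists i.+1. Qed.

Lemma Ge_G5 i g : Ge i.+1 g -> G5 g.
Proof. by move=> gi; apply: (@Glev_G5 i); left. Qed.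

(** Elements of the G_{i,e} have equal left and right components, so a pair
    taken from the left side of such an element may be read as taken from its
    right side; this is what makes the middle component of a tuple in G_{i+1,e}
    obey the same rule as in G_{i+1,d}. *)
Lemma Ge_tl i g : Ge i.+1 g ->
  (tl g = Sym One \/ G5 (tl g)) /\ tl g = tr g.
Proof.
case: i => [->|i [h hi ghE]]; first by split => //; left.
have h5 := Ge_G5 hi.
by case: ghE => -> /=; split => //; right.
Qed.

(** Conditions (2) and (3) in the definition of G_{i,d}, which the elements of
    G_{i,e} satisfy as well, say that [g^c] lies below both [g^l] and [g^r] in the
    graph, along edges labelled [g^la'] and [g^ra']. *)
Lemma G5_cases g : G5 g -> g = gxx' \/
  [/\ (2 <= height g)%N, up (tc g) (bar (tla g)) (tl g),
      up (tc g) (bar (tra g)) (tr g) & tc g = Sym One \/ G5 (tc g)].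
Proof.
case=> -[//|[_|i _]] gi; first by left; case: gi.
right; rewrite (Glev_height gi); split=> //.
- case: gi => [[h hi [] ->] /=|]; rewrite /up ?barK.
  + by split; [exact: Ge_G5 hi|left].
  + by split; [exact: Ge_G5 hi|right; have [_ ->] := Ge_tl hi].
  case: i => [//|i]; case: g => // l la c ra r /= [[lG _ _] [_ cl _]].
  by split; [exact: (@Glev_G5 i.+1)|case: cl => -[-> ->]; rewrite barK; [left|right]].
- case: gi => [[h hi [] ->] /=|]; rewrite /up ?barK.
  + by split; [exact: Ge_G5 hi|right; have [_ ->] := Ge_tl hi].
  + by split; [exact: Ge_G5 hi|left].
  case: i => [//|i]; case: g => // l la c ra r /= [[_ _ rG] [_ _ cr]].
  by split; [exact: (@Glev_G5 i.+1)|case: cr => -[-> ->]; rewrite barK; [left|right]].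
- case: gi => [[h hi [] ->] /=|]; try by have [] := Ge_tl hi.
  case: i => [//|i]; case: g => // l la c ra r /= [[_ cG _] _].
  by right; apply: (@Glev_G5 i).
Qed.

Lemma up_height k s p : up k s p -> height p = (height k).+1.
Proof.
case=> pG.
have [p0 pi] := G5_height pG; move: p0 pi; case E: (height p) => [//|[|i]] _ pi.
  by case: pi => // pE [] [-> _]; rewrite pE.
have [lG rG _] := Glev_components pi.
by case=> -[-> _]; rewrite ?(Glev_height lG) ?(Glev_height rG).
Qed.

(** The tuple that fills a valley.  The only obstruction to its being in G_{i,d}
    is [p = q].  In that case either both slopes are the same edge and cancel, or
    they are the two different sides of [p]; then [p^l = p^r], which forces [p]
    into some G_{i,e}, and the tuple is one of the two it spawns in G_{i+1,e}. *)
Lemma up_fill k s t p q : up k t p -> up k s q -> (p = q /\ t = s) \/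
  (G5 (Tup q (bar s) k (bar t) p) /\ (2 <= height (Tup q (bar s) k (bar t) p))%N).
Proof.
move=> ptk qsk; have hp := up_height ptk; have hq := up_height qsk.
have [[pG pk] [qG qk]] := (ptk, qsk).
have [p0 pi] := G5_height pG; have [q0 qi] := G5_height qG.
have [[<- ->]|npq] := pselect ((p, t) = (q, s)); first by left.
right; split; last by rewrite /= hq.
have [pq|pq] := pselect (p = q).
  have {}pk : tl p = tr p /\
      ((k, t, s) = (tl p, tla p, tra p) \/ (k, t, s) = (tl p, tra p, tla p)).
    move: pk qk npq; rewrite -pq => -[] [kE tE] [] [kE' sE] npq.
    - by case: npq; rewrite tE sE.
    - by split; [rewrite -kE|left; rewrite kE tE sE].
    - by split; [rewrite -kE'|right; rewrite kE' tE sE].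
    - by case: npq; rewrite tE sE.
  have {}pi : Ge (height p) p.
    move: pi pk; rewrite hp; case: (height k) => [|[|i]] [//|] //.
    by case: (p) => // l la c ra r [_ [lr _ _]] [/lr].
  apply: (@Ge_G5 (height p)); rewrite hp -pq; exists p; first by rewrite -hp.
  by case: pk => _ [] [-> -> ->]; [right|left].
move: pi qi; rewrite hp hq; case hk: (height k) => [|i] pi qi.
  by move: pi qi => [pE|//] [qE|//]; case: pq; rewrite pE.
apply: (@Glev_G5 i.+2); right; split; split=> //.
- have [lG rG _] := Glev_components pi.
  by case: pk => -[-> _].
- exact/nesym.
- by case: qk => -[-> ->]; [left|right].
- by case: pk => -[-> ->]; [left|right].
Qed.

(** * Regularity of the interpretations of the relations *)

(** The defining relations of F_1^1, for a map defined on all trees, so that the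
    components of a tuple can be used without membership proofs. *)
Record model (M : monoidType) (phi : tree -> M) : Prop := Model {
  model1 : phi (Sym One) = 1;
  modelX : phi (Sym X) * phi (Sym X') * phi (Sym X) = phi (Sym X);
  modelX' : phi (Sym X') * phi (Sym X) * phi (Sym X') = phi (Sym X');
  model_gxx' : phi gxx' = phi (Sym X) * phi (Sym X');
  model_idem g : G5 g -> phi g * phi g = phi g;
  model_L g : G5 g -> (2 <= height g)%N ->
    phi (tc g) * (phi (Sym (bar (tla g))) * phi (tl g) * phi (Sym (tla g)))
      * phi g = phi g;
  model_R g : G5 g -> (2 <= height g)%N ->
    phi g * (phi (Sym (bar (tra g))) * phi (tr g) * phi (Sym (tra g)))
      * phi (tc g) = phi g;
  model_M g : G5 g -> (2 <= height g)%N ->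
    phi (tr g) * phi (Sym (tra g)) * phi g * phi (Sym (bar (tla g)))
      * phi (tl g) =
    phi (tr g) * phi (Sym (tra g)) * phi (tc g) * phi (Sym (bar (tla g)))
      * phi (tl g)
}.

(** Applied to [L = g^L] and [R = g^R]: because [c] is idempotent, the
    relations for [g] give [g c = g = c g], and then [c] can be dropped from
    [g c L g = g] and [g R c g = g]. *)
Lemma absorb_between (M : semigroupType) (c L R g : M) :
  c * c = c -> g * g = g -> c * L * g = g -> g * R * c = g ->
  g * L * g = g /\ g * R * g = g.
Proof.
move=> cc gg cLg gRc.
have gc : g * c = g by rewrite -gRc -!mulgA cc.
have cg : c * g = g by rewrite -cLg !mulgA cc.
split; first by rewrite -{1}gc -!mulgA (mulgA c) cLg gg.
by rewrite -{2}cg mulgA gRc gg.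
Qed.

Section Landscape.
Variables (M : monoidType) (phi : tree -> M).
Hypothesis phiM : model phi.
Local Notation sg s := (phi (Sym s)).

Lemma model_idem1 g : g = Sym One \/ G5 g -> phi g * phi g = phi g.
Proof. by case=> [->|/(model_idem phiM)//]; rewrite (model1 phiM) mulg1. Qed.

(** Going down an edge and back up is trivial.  For [g] of height at least 2 this
    says [g g^L g = g] and [g g^R g = g]; for [g_xx']
    both edges give idempotence, since [g_xx' x x' g_xx' = g_xx'^3]. *)
Lemma up_down k s p : up k s p -> phi p * sg (bar s) * phi k * sg s * phi p = phi p.
Proof.
case=> pG pk; have [pE|[p2 _ _ pc]] := G5_cases pG.
  have pp := model_idem phiM pG; move: pk; rewrite pE /= in pp *.
  case=> -[-> ->] /=; rewrite (model1 phiM) ?mulg1 //.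
  by rewrite -(mulgA _ _ (sg X')) -(model_gxx' phiM) !pp.
have [pL pR] := absorb_between (model_idem1 pc) (model_idem phiM pG)
  (model_L phiM pG p2) (model_R phiM pG p2).
by rewrite !mulgA in pL pR; case: pk => -[-> ->].
Qed.

(** [ascent k p u u']: some upward path from [k] to [p] has value [u], and the
    same path traversed downwards has value [u']. *)
Inductive ascent : tree -> tree -> M -> M -> Prop :=
  | ascent_nil k : k = Sym One \/ G5 k -> ascent k k (phi k) (phi k)
  | ascent_cons k s k1 p u u' : k = Sym One \/ G5 k -> up k s k1 ->
      ascent k1 p u u' ->
      ascent k p (phi k * sg s * u) (u' * sg (bar s) * phi k).

Lemma ascent_absorb k p u u' : ascent k p u u' ->
  [/\ phi k * u = u, u * phi p = u, u' * phi k = u' & phi p * u' = u'].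
Proof.
elim=> [{}k kG|{}k s k1 {}p {}u {}u' kG _ _ [_ up_ _ pu]].
  by split; exact: model_idem1.
split; first by rewrite !mulgA (model_idem1 kG).
- by rewrite -mulgA up_.
- by rewrite -mulgA (model_idem1 kG).
- by rewrite !mulgA pu.
Qed.

(** [u'] descends from [p] along the path that [u] climbs, so [up_down] cancels
    the edges from the bottom one on. *)
Lemma ascent_inv k p u u' : ascent k p u u' -> u' * u = phi p.
Proof.
elim=> [{}k kG|{}k s k1 {}p {}u {}u' kG kk1 a1 u'u].
  exact: model_idem1.
have [k1u _ u'k1 _] := ascent_absorb a1.
have -> : u' * sg (bar s) * phi k * (phi k * sg s * u) =
          u' * (phi k1 * sg (bar s) * phi k * sg s * phi k1) * u.
  by rewrite !mulgA u'k1 -!mulgA k1u (mulgA (phi k) (phi k)) (model_idem1 kG).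
by rewrite (up_down kk1) u'k1.
Qed.

Lemma ascent_rcons k p u u' s q : ascent k p u u' -> up p s q ->
  ascent k q (u * sg s * phi q) (phi q * sg (bar s) * u').
Proof.
move=> a; elim: a => {k p u u'} [p pG|k t k1 p u u' kG kk1 _ IH] pq.
  by apply: (ascent_cons pG pq); apply: ascent_nil; right; case: pq.
have -> : phi k * sg t * u * sg s * phi q = phi k * sg t * (u * sg s * phi q).
  by rewrite !mulgA.
rewrite (mulgA _ _ (phi k)) (mulgA _ u').
by apply: (ascent_cons kG kk1); apply: IH.
Qed.

Definition mountain j k w :=
  exists p u u' v v', [/\ ascent j p u u', ascent k p v v' & w = u * v'].

Lemma mountain_regular j k w : mountain j k w ->
  exists2 w', mountain k j w' & w * w' * w = w.
Proof.
case=> p [u [u' [v [v' [ju kv ->]]]]].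
exists (v * u'); first by exists p, v, v', u, u'.
have [_ up_ _ _] := ascent_absorb ju.
rewrite -!mulgA (mulgA u' u) (ascent_inv ju) (mulgA v' v) (ascent_inv kv).
by rewrite !mulgA !up_.
Qed.

Lemma mountain_down j k w s q : mountain j k w -> q = Sym One \/ G5 q ->
  up q s k -> mountain j q (w * sg (bar s) * phi q).
Proof.
case=> p [u [u' [v [v' [ju kv ->]]]]] qG qk.
exists p, u, u', (phi q * sg s * v), (v' * sg (bar s) * phi q); split=> //.
  exact: (ascent_cons qG qk kv).
by rewrite !mulgA.
Qed.

(** An upward edge after a descent meets a valley at [k].  It cancels against
    the last edge of the descent, or is filled by a peak [d]; in the latter case
    the rest of the descent is followed by the upward edge to [d], which is
    handled by induction on the length of the descent, and then by the downward
    edge from [d] to [q]. *)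
Lemma ascent_up k p v v' : ascent k p v v' ->
  forall j u u' s q, ascent j p u u' -> up k s q ->
  mountain j q (u * v' * sg s * phi q).
Proof.
elim=> {k p v v'} [k kG|k t k1 p v v' kG kk1 a1 IH] j u u' s q ju kq.
  have qG : G5 q by case: kq.
  have [_ up_ _ _] := ascent_absorb ju.
  exists q, (u * sg s * phi q), (phi q * sg (bar s) * u'), (phi q), (phi q).
  split; [exact: ascent_rcons ju kq|by apply: ascent_nil; right|].
  by rewrite up_ -!mulgA (model_idem phiM qG).
have [_ _ v'k1 _] := ascent_absorb a1.
have [[<- <-]|[dG d2]] := up_fill kk1 kq.
  exists p, u, u', v, v'; split=> //.
  by rewrite -{1}v'k1 !mulgA -!(mulgA (u * v')) (up_down kk1) -mulgA v'k1.
have k1d : up k1 (bar t) (Tup q (bar s) k (bar t) k1) by split=> //; right.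
have qd : up q (bar s) (Tup q (bar s) k (bar t) k1) by split=> //; left.
have := mountain_down (IH _ _ _ _ _ ju k1d) _ qd.
have := model_M phiM dG d2; rewrite /= !barK => dM.
suff -> : u * v' * sg (bar t) * phi (Tup q (bar s) k (bar t) k1) * sg s * phi q
       = u * (v' * sg (bar t) * phi k) * sg s * phi q.
  by apply; right; case: kq.
by rewrite -v'k1 !mulgA -!(mulgA (u * v')) dM.
Qed.

Lemma mountain_up j k w s q : mountain j k w -> up k s q ->
  mountain j q (w * sg s * phi q).
Proof.
by case=> p [u [u' [v [v' [ju kv ->]]]]]; apply: ascent_up kv _ _ _ _ _ ju.
Qed.

Lemma mountain_absorb j k w : mountain j k w -> w * phi k = w.
Proof.
case=> p [u [u' [v [v' [_ kv ->]]]]].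
by have [_ _ v'k _] := ascent_absorb kv; rewrite -mulgA v'k.
Qed.

(** Each letter [g] is the value both of a walk from 1 to [g] and of a walk from
    [g] to 1: by [g = g^c g^L g], the first goes to [g^c], then up through [g^l];
    by [g = g g^R g^c], the second goes down through [g^r] to [g^c], and on.
    Walks are represented by their action on mountains that end at their
    starting point. *)
Lemma mountain_letter g : g = Sym One \/ G5 g -> forall j w,
  (mountain j (Sym One) w -> mountain j g (w * phi g)) /\
  (mountain j g w -> mountain j (Sym One) (w * phi g)).
Proof.
have m1 := model1 phiM.
elim: g => [a|l _ la c IHc ra r _] gG j w.
  by case: gG => [->|[[|i] // _ /Glev_height//]]; rewrite m1 mulg1.
case: gG => // gG; have [gE|[g2 cl cr cG]] := G5_cases gG.
  rewrite gE in gG *; have up1 : up (Sym One) One gxx' by split=> //; left.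
  split=> wG; first by have := mountain_up wG up1; rewrite m1 mulg1.
  by have := mountain_down wG (or_introl erefl) up1;
    rewrite m1 !mulg1 (mountain_absorb wG).
have lG : up l la (Tup l la c ra r) by split=> //; left.
have rG : up r ra (Tup l la c ra r) by split=> //; right.
split=> wG.
  have := mountain_up (mountain_up ((IHc cG j w).1 wG) cl) lG.
  by rewrite -{2}(model_L phiM gG g2) /= !mulgA.
have r5 : G5 r by case: cr.
have := mountain_down (mountain_down wG (or_intror r5) rG) cG cr.
move=> /((IHc cG _ _).2); rewrite /= barK -mulgA (model_idem1 cG).
suff -> : w * sg (bar ra) * phi r * sg ra * phi c = w * phi (Tup l la c ra r).
  by [].
rewrite -{1}(mountain_absorb wG) -[in RHS](model_R phiM gG g2) /=.
by rewrite !mulgA.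
Qed.

Definition eval (w : word) : M := \prod_(g <- val w) phi (val g).

Lemma evalM : {morph eval : u v / u * v}.
Proof. by move=> u v; rewrite /eval big_cat. Qed.

Lemma eval_letter g : eval (letter g) = phi (val g).
Proof. by rewrite /eval big_seq1. Qed.

Lemma G_cases (g : G) : G5 (val g) \/ exists a, val g = Sym a.
Proof. by have [|[a _ <-]] := set_mem (valP g); [left|right; exists a]. Qed.

(** A letter of G' is idempotent, hence has the value of a walk to it and back;
    [x] and [x'] are the closed walks at 1 that go up one side of [g_xx'] and
    down the other, since [g_xx' x = x] and [x' g_xx' = x']. *)
Lemma mountain_eval u : mountain (Sym One) (Sym One) (eval u).
Proof.
suff: forall w, mountain (Sym One) (Sym One) w ->
      mountain (Sym One) (Sym One) (w * eval u).
  move/(_ 1); rewrite mul1g; apply.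
  exists (Sym One), (phi (Sym One)), (phi (Sym One)), (phi (Sym One)), (phi (Sym One)).
  by split; [apply: ascent_nil; left..|rewrite (model1 phiM) mulg1].
have gG : G5 gxx' by apply: (@Ge_G5 0).
have up1 : up (Sym One) One gxx' by split=> //; left.
have upX' : up (Sym One) X' gxx' by split=> //; right.
elim/word_ind: u => [g|u v IHu IHv] w wG; last first.
  by rewrite evalM mulgA; apply/IHv/IHu.
rewrite eval_letter; have m1 := model1 phiM; have [g5|[[] ->]] := G_cases g.
- have gG' : val g = Sym One \/ G5 (val g) by right.
  rewrite -(model_idem phiM g5) mulgA.
  by apply/(mountain_letter gG' _ _).2/(mountain_letter gG' _ _).1.
- by rewrite m1 mulg1.
- have := mountain_down (mountain_up wG up1) (or_introl erefl) upX'.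
  by rewrite m1 !mulg1 (model_gxx' phiM) -mulgA (modelX phiM).
- have := mountain_down (mountain_up wG upX') (or_introl erefl) up1.
  by rewrite m1 !mulg1 (model_gxx' phiM) mulgA -!(mulgA w) (modelX' phiM).
Qed.

Lemma ascent_eval k p u u' : ascent k p u u' ->
  (exists w, eval w = u) /\ (exists w, eval w = u').
Proof.
have val1 g : g = Sym One \/ G5 g -> exists w, eval w = phi g.
  move=> gG; have gP : g \in Gset.
    by apply/mem_set; case: gG => [->|]; [right; exists One|left].
  by exists (letter (Sub g gP)); rewrite eval_letter.
have sgE a : eval (sletter a) = sg a by rewrite eval_letter.
elim=> [{}k kG|{}k s k1 {}p {}u {}u' kG _ _ [[w <-] [w' <-]]].
  by split; apply: val1.
have [v vE] := val1 _ kG.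
split; [exists (v * sletter s * w)|exists (w' * sletter (bar s) * v)];
  by rewrite !evalM sgE vE.
Qed.

Theorem eval_regular u : exists v, eval u * eval v * eval u = eval u.
Proof.
have [w [p [a [a' [b [b' [ja kb ->]]]]]] uwu] := mountain_regular (mountain_eval u).
have [[v vE] _] := ascent_eval ja; have [_ [v' v'E]] := ascent_eval kb.
by exists (v * v'); rewrite evalM vE v'E.
Qed.

Lemma eval_rho u v : rho u v -> eval u = eval v.
Proof.
move=> uv; apply/eqP; move: u v uv.
apply: (rho_min (R := fun u v => eval u == eval v)).
  split=> [u|u v|v u w /eqP-> //|u u' v v' /eqP uu' /eqP vv'].
  - exact: eqxx.
  - exact: eq_sym.
  - by rewrite !evalM uu' vv'.
move=> _ _ [|||g|g|g gG|g gG g2|g gG g2|g gG g2]; apply/eqP;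
  rewrite ?evalM !eval_letter /=.
- exact: modelX.
- exact: modelX'.
- exact: model_gxx'.
- by rewrite (model1 phiM) mul1g.
- by rewrite (model1 phiM) mulg1.
- by apply: model_idem1; case: gG; [right|left].
- exact: model_L.
- exact: model_R.
- exact: model_M.
Qed.

End Landscape.

(** * Realizing the relations in a regular monoid *)

Section Interpretation.
Variables (M : monoidType) (inv : M -> M).
Hypothesis invP : forall w, w * inv w * w = w /\ inv w * w * inv w = inv w.
Variable x : M.

Definition isym (s : symb) : M :=
  match s with One => 1 | X => x | X' => inv x end.

(** The only tuple of G whose left component is a symbol is [g_xx']. *)
Fixpoint interp (g : tree) : M :=
  match g with
  | Sym s => isym s
  | Tup (Sym _) _ _ _ _ => x * inv x
  | Tup l la c ra r =>
    interp c * isym (bar la) * interp l *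
    inv (interp r * isym ra * interp c * isym (bar la) * interp l) *
    (interp r * isym ra * interp c)
  end.

(** Here [p], [p'], [q], [q'] stand for the images of [g^la], [g^la'], [g^ra],
    [g^ra'].  The hypotheses on [l] and [r] make [c p' l p] and [q' r q c]
    idempotent, and the element [g] is a variant of Nambooripad's sandwich
    elements for them. *)
Lemma sandwich_of_inverse (l r c p p' q q' : M) (w := r * q * c * p' * l)
    (g := c * p' * l * inv w * (r * q * c)) :
    c * c = c -> l * p * c * p' * l = l -> r * q * c * q' * r = r ->
  [/\ g * g = g, c * (p' * l * p) * g = g, g * (q' * r * q) * c = g &
      r * q * g * p' * l = r * q * c * p' * l].
Proof.
move=> cc lE rE; have [wtw twt] := invP w.
have lE' u : u * l * p * c * p' * l = u * l by rewrite -[in RHS]lE !mulgA.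
have rE' u : u * r * q * c * q' * r = u * r by rewrite -[in RHS]rE !mulgA.
have cc' u : u * c * c = u * c by rewrite -mulgA cc.
have twt' u : u * inv w * r * q * c * p' * l * inv w = u * inv w.
  by rewrite -[in RHS]twt /w !mulgA.
split; rewrite /g !mulgA ?cc' ?twt' ?lE' ?rE' //.
by rewrite !mulgA in wtw; rewrite wtw.
Qed.

(** All the relations for [g] have to be proved together with the triviality of
    the edges below [g]: the hypotheses of [sandwich_of_inverse] for a tuple are
    that the edges from [g^c] to [g^l] and [g^r] are trivial. *)
Lemma interp_model : model interp.
Proof.
have xE := invP x.
have eE : interp gxx' = x * inv x by [].
have relations g : G5 g ->
  [/\ interp g * interp g = interp g,
      (2 <= height g)%N -> [/\
        interp (tc g) * (interp (Sym (bar (tla g))) * interp (tl g)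
          * interp (Sym (tla g))) * interp g = interp g,
        interp g * (interp (Sym (bar (tra g))) * interp (tr g)
          * interp (Sym (tra g))) * interp (tc g) = interp g &
        interp (tr g) * interp (Sym (tra g)) * interp g
          * interp (Sym (bar (tla g))) * interp (tl g) =
        interp (tr g) * interp (Sym (tra g)) * interp (tc g)
          * interp (Sym (bar (tla g))) * interp (tl g)] &
      forall k s, up k s g ->
        interp g * interp (Sym (bar s)) * interp k * interp (Sym s) * interp g
          = interp g].
  elim: g => [a [[|i] // _ /Glev_height//]|l IHl la c IHc ra r IHr] gG.
  have [gE|[g2 cl cr cG]] := G5_cases gG.
    have ee : interp gxx' * interp gxx' = interp gxx'.
      by rewrite eE mulgA xE.1.
    rewrite gE; split=> // k s [_ /= [] [-> ->]] /=; rewrite ?mulg1 //.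
    by rewrite -(mulgA _ x) -eE !ee.
  have l5 : G5 l by case: cl.
  have r5 : G5 r by case: cr.
  have [_ _ /(_ _ _ cl) lE] := IHl l5; have [_ _ /(_ _ _ cr) rE] := IHr r5.
  have cc : interp c * interp c = interp c.
    by case: cG => /= [->|/IHc[]//]; rewrite mulg1.
  rewrite /= !barK in lE rE.
  have [gg gL gR gM] := sandwich_of_inverse cc lE rE.
  have gE : interp (Tup l la c ra r) =
    interp c * isym (bar la) * interp l *
    inv (interp r * isym ra * interp c * isym (bar la) * interp l) *
    (interp r * isym ra * interp c) by case: (l) g2.
  rewrite -gE in gg gL gR gM; split=> // k s [_ ks].
  have [pL pR] := absorb_between cc gg gL gR.
  by rewrite !mulgA in pL pR; case: ks => /= -[-> ->].
split=> //; try exact: xE.1; try exact: xE.2.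
- by move=> g /relations[].
- by move=> g /relations[_ LRM _] /LRM[].
- by move=> g /relations[_ LRM _] /LRM[].
- by move=> g /relations[_ LRM _] /LRM[].
Qed.

End Interpretation.

(** * Adjoining an identity *)

(** The identity is new even when [S] already has one, so that only words in the
    letter 1 can be sent to it. *)
Definition with_one (S : semigroupType) := option S.

Section WithOne.
Variable S : semigroupType.

HB.instance Definition _ := Choice.on (with_one S).

(** * Adjoining an identity *)

(** The identity is new even when [S] already has one, so that only words in the
    letter 1 can be sent to it. *)
Definition with_one_mul (s t : with_one S) : with_one S :=
  match s, t with
  | Some s, Some t => Some (s * t)
  | None, t => t
  | s, None => s
  end.

Fact with_one_mulA : associative with_one_mul.
Proof. by move=> [s|] [t|] [u|] //=; rewrite mulgA. Qed.

Fact with_one_mul1s : left_id None with_one_mul.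
Proof. by case. Qed.

Fact with_one_muls1 : right_id None with_one_mul.
Proof. by case. Qed.

HB.instance Definition _ := isMonoid.Build (with_one S)
  with_one_mulA with_one_mul1s with_one_muls1.

Lemma with_one_regular : regular S -> regular (with_one S).
Proof.
move=> Sreg [s|]; last by exists None.
by have [t sts] := Sreg s; exists (Some t); congr Some.
Qed.

End WithOne.

Lemma regular_inverse (S : semigroupType) : regular S ->
  forall s : S, exists t, s * t * s = s /\ t * s * t = t.
Proof.
move=> Sreg s; have [t sts] := Sreg s; exists (t * s * t).
have sts' u : u * s * t * s = u * s by rewrite -[in RHS]sts !mulgA.
by rewrite !mulgA !sts !sts'.
Qed.

Lemma with_one_mul_eq1 (S : semigroupType) (s t : with_one S) :
  s * t = 1 -> s = 1 /\ t = 1.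
Proof. by case: s t => [s|] [t|]. Qed.

(** * The homomorphism onto S *)

Theorem theorem5p5 (S : semigroupType) (a : S)
    (S_regular : regular S)
    (S_wgen : weakly_generated [set a]%classic) :
  exists f : {multiplicative F1 -> S},
    (forall s : S, exists u : F1, f u = s) /\ f F1_x = a.
Proof.
have [inv invP] := choice (regular_inverse (with_one_regular S_regular)).
pose phi := interp inv (Some a : with_one S).
have phiM : model phi := interp_model invP _.
pose ev := eval phi.
have phiN g : phi g = 1 -> g = Sym One.
  elim: g => [[|//|/= aE]|l IHl la c _ ra r _ gE].
  - by [].
  - by have [_] := invP (Some a : with_one S); rewrite aE.
  have : phi l = 1 /\ l <> Sym One; last by move=> [/IHl].
  case: l gE {IHl} => [s /= /with_one_mul_eq1[]//|l' la' c' ra' r'].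
  by case/with_one_mul_eq1=> /with_one_mul_eq1[/with_one_mul_eq1[_ lE] _] _.
have evN u : has_non1 u -> ev u <> 1.
  elim/word_ind: u => [g|u v IHu IHv].
    by rewrite has_non1_letter /ev eval_letter => /eqP gN /phiN.
  rewrite has_non1M /ev evalM => uvN /with_one_mul_eq1[uE vE].
  by case/orP: uvN => [/IHu|/IHv].
have ev_repr u : ev (repr (\pi_F11 u)%qT) = ev u.
  by apply: eval_rho => //; apply/F11_eqP; rewrite reprK.
pose f (p : F1) : S := if ev (repr (val p)) is Some s then s else a.
have fP (p : F1) : Some (f p) = ev (repr (val p)).
  have /evN : has_non1 (repr (val p)).
    have := valP p; rewrite /= /F1_pred -{1}(reprK (val p)) pi_F11_eq1.
    by rewrite negbK.
  by rewrite /f; case: (ev _).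
have fM : {morph f : p q / p * q}.
  move=> p q; apply: Some_inj; rewrite fP.
  rewrite -[RHS]/((Some (f p) : with_one S) * Some (f q)) !fP /ev -evalM -/ev.
  by rewrite -[in RHS]ev_repr pi_F11M !reprK.
pose F : {multiplicative F1 -> S} := HB.pack f (isMultiplicative.Build F1 S f fM).
exists F; split; last first.
  by apply: Some_inj; rewrite [LHS]fP ev_repr /ev eval_letter.
pose T := [set s | exists u, ev u = Some s]%classic.
have T_eval s : T s -> exists u : F1, F u = s.
  case=> u uE.
  have uP : F1_pred (\pi_F11 u)%qT.
    rewrite /F1_pred pi_F11_eq1 negbK; case uN: (has_non1 u) => //.
    move/negbT: uN; rewrite -pi_F11_eq1 => /eqP uN.
    have := ev_repr u; rewrite uN ev_repr uE.
    by rewrite /ev eval_letter.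
  by exists (Sub _ uP); apply: Some_inj; rewrite [LHS]fP /= ev_repr.
have TT : T = setT.
  apply: S_wgen; last by move=> _ ->; exists (sletter X); rewrite /ev eval_letter.
  split=> [s t [u uE] [v vE]|s [u uE]].
    by exists (u * v); rewrite /ev evalM -/ev uE vE.
  have [v] := eval_regular phiM u; rewrite -/ev uE => vE.
  have [t tE] : exists t, ev (v * u * v) = Some t.
    by rewrite /ev !evalM -/ev uE; case: (ev v) => [r|]; eexists.
  (* [ev v] may be the adjoined identity, whereas [ev (v * u * v)] lies in [S]. *)
  exists t; first by exists (v * u * v).
  apply: Some_inj.
  rewrite -[LHS]/((Some s : with_one S) * Some t * Some s) -tE -{1 2}uE.
  by rewrite /ev !evalM -/ev uE !mulgA !vE.
by move=> s; apply: T_eval; rewrite TT.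
Qed.
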